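(* Given a radially decreasing function $g$ in $\mathbb{R}^n$, one has for $p>2$ \[ M_{\nu_n}g(x)\leq \frac{p+2}{p-2}\left(\mathcal A g^p(x)\right)^{1/p} \] for each $x\in\mathbb{R}^n$.
   Context: $B(x,R)$ denotes the Euclidean ball in $\mathbb{R}^n$ centred at $x$ with radius $R$, $B_r=B(0,r)$, and $|A|$ is the Lebesgue measure of a set $A$. $\nu_n$ is the measure on $\mathbb{R}^n$ whose density is the characteristic function of the unit ball $B_1$. The maximal function associated to a Radon measure $\mu$ is \[ M_\mu g(x)=\sup_{R>0,\ \mu(B(x,R))>0}\frac1{\mu(B(x,R))}\int_{B(x,R)}|g(y)|\,d\mu(y). \] The Hardy operator is defined for a locally integrable function $g$ in $\mathbb{R}^n$ by $\mathcal A g(x)=\frac1{|B_{|x|}|}\int_{B_{|x|}}g(y)\,dy$, and $\mathcal A g^p$ denotes $\mathcal A$ applied to the function $g^p$. A radially decreasing function is a nonnegative function of the form $g(x)=g_0(|x|)$ with $g_0$ non-increasing.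
   Formalization: Proved for |x| ≤ 1 only: for large |x| the claim fails (g the indicator of B_1, n=1, p=4, x=100 gives 1 > 0.95). At x = 0, where the Hardy average is 0/0, it is read as the limit of averages over shrinking centred balls. *)

(* Defs.v *)
From HB Require Import structures.
From mathcomp Require Import all_boot all_order all_algebra.
From mathcomp Require Import all_classical all_reals all_analysis.
From mathcomp Require Import measurable_realfun.
Set Implicit Arguments.
Unset Strict Implicit.
Unset Printing Implicit Defensive.
Import Order.TTheory GRing.Theory Num.Theory.
Import numFieldNormedType.Exports.
Local Open Scope classical_set_scope.
Local Open Scope ring_scope.

(* R^n is [n.-tuple R], with the library's product sigma-algebra, which is the
   Borel one. *)

Section euclidean.
Context {R : realType} {n : nat}.
Implicit Types x y : n.-tuple R.

Definition enorm x : R := Num.sqrt (\sum_(i < n) tnth x i ^+ 2).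

Definition evec0 : n.-tuple R := [tuple 0 | i < n].

Definition eball x (r : R) : set (n.-tuple R) :=
  [set y | enorm [tuple tnth y i - tnth x i | i < n] < r].

Lemma measurable_eball x r : measurable (eball x r).
Proof.
have mf : measurable_fun [set: n.-tuple R]
    (fun y => enorm [tuple tnth y i - tnth x i | i < n]).
  rewrite /enorm; apply: (@measurableT_comp _ _ _ _ _ _ (@Num.sqrt R)).
    exact: (continuous_measurable_fun (@sqrt_continuous R)).
  apply: measurable_sum => i.
  under eq_fun do rewrite tnth_mktuple.
  apply: measurable_funX; apply: measurable_funB => //.
  exact: measurable_tnth.
rewrite (_ : eball x r = setT `&`
    (fun y => enorm [tuple tnth y i - tnth x i | i < n]) @^-1` [set` `]-oo, r[]).
  exact: mf.
by rewrite setTI; apply/seteqP; split => y /=; rewrite in_itv.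
Qed.

End euclidean.

Definition tcons {R : realType} n (xv : measurableTypeR R * n.-tuple R) :
    n.+1.-tuple R :=
  [the n.+1.-tuple R of xv.1 :: xv.2].

(* n-dimensional Lebesgue measure, as the n-fold product of the one-dimensional
   one. [measurableTypeR R] is the type on which the library puts
   [lebesgue_measure]; it is R with the same measurable sets. *)
Fixpoint lebesgue_tuple {R : realType} (n : nat) : set (n.-tuple R) -> \bar R :=
  match n with
  | 0%N => dirac [tuple]
  | m.+1 => pushforward (lebesgue_measure \x @lebesgue_tuple R m)%E (@tcons R m)
  end.

Section lebesgue_tuple_measure.
Context {R : realType}.

Lemma measurable_tcons n : measurable_fun setT (@tcons R n).
Proof. exact: measurable_cons. Qed.

Let sigma_finite_measureP d (T : measurableType d) (q : set T -> \bar R) :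
    q set0 = 0%E -> (forall A, 0 <= q A)%E -> semi_sigma_additive q ->
    sigma_finite setT q ->
  exists mu : {sigma_finite_measure set T -> \bar R}, q = mu :> (set T -> \bar R).
Proof.
move=> q0 qge0 qS sf.
pose m1 := isMeasure.Build _ _ _ q q0 qge0 qS.
pose q1 : {measure set T -> \bar R} := HB.pack q m1.
pose m2 := Measure_isSigmaFinite.Build _ _ _ q1 sf.
pose q2 : {sigma_finite_measure set T -> \bar R} := HB.pack q m1 m2.
by exists q2.
Qed.

Let lebesgue_tupleP n :
  exists mu : {sigma_finite_measure set (n.-tuple R) -> \bar R},
    @lebesgue_tuple R n = mu :> (set (n.-tuple R) -> \bar R).
Proof.
elim: n => [|n [mu mE]]; first by exists (dirac [tuple]).
rewrite /= mE.
pose p : {measure set (measurableTypeR R * n.-tuple R)%type -> \bar R} :=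
  (@lebesgue_measure R \x mu)%E.
pose tl (w : n.+1.-tuple R) :=
  (thead w, [tuple of behead w]) : measurableTypeR R * n.-tuple R.
have tlK xv : tl (tcons xv) = xv.
  by case: xv => x v; rewrite /tl /tcons /= theadE; congr pair; apply/val_inj.
have mtl : measurable_fun setT tl.
  apply: measurable_fun_pair; first exact: (@measurable_tnth _ R).
  exact: measurable_behead.
have /sigma_finiteP[F [TF ndF Foo]] := sigma_finiteT (@lebesgue_measure R).
have /sigma_finiteP[G [TG ndG Goo]] := sigma_finiteT mu.
pose q := pushforward p (@tcons R n).
have sf : sigma_finite setT q.
  exists (fun k => tl @^-1` (F k `*` G k)).
    rewrite -preimage_bigcup (_ : \bigcup_k _ = setT) ?preimage_setT//.
    apply/seteqP; split=> // -[a b] _.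
    have [i _ Fia] : (\bigcup_k F k) a by rewrite -TF.
    have [j _ Gjb] : (\bigcup_k G k) b by rewrite -TG.
    exists (maxn i j) => //; split => /=.
      by move: a Fia; exact/subsetPset/ndF/leq_maxl.
    by move: b Gjb; exact/subsetPset/ndG/leq_maxr.
  move=> k; have [mF Fk] := Foo k; have [mG Gk] := Goo k; split.
    by rewrite -[X in measurable X]setTI; apply: mtl => //; exact: measurableX.
  rewrite /q /pushforward -comp_preimage (_ : tl \o @tcons R n = id); last first.
    by apply/funext => xv /=; rewrite tlK.
  by rewrite preimage_id /p /= product_measure1E// lte_mul_pinfty// ge0_fin_numE.
have mt := @measurable_tcons n.
have q0 : q set0 = 0%E by exact: measure0.
have qge0 A : (0 <= q A)%E by exact: measure_ge0.
have qS : semi_sigma_additive q by exact: measure_semi_sigma_additive.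
exact: sigma_finite_measureP.
Qed.

Let lebesgue_tuple0 n : @lebesgue_tuple R n set0 = 0%E.
Proof. by have [mu ->] := lebesgue_tupleP n. Qed.

Let lebesgue_tuple_ge0 n A : (0 <= @lebesgue_tuple R n A)%E.
Proof. by have [mu ->] := lebesgue_tupleP n. Qed.

Let lebesgue_tuple_sigma_additive n : semi_sigma_additive (@lebesgue_tuple R n).
Proof.
by have [mu ->] := lebesgue_tupleP n; exact: measure_semi_sigma_additive.
Qed.

HB.instance Definition _ n := isMeasure.Build _ _ _ (@lebesgue_tuple R n)
  (@lebesgue_tuple0 n) (@lebesgue_tuple_ge0 n) (@lebesgue_tuple_sigma_additive n).

Let lebesgue_tuple_sigma_finite n : sigma_finite setT (@lebesgue_tuple R n).
Proof. by have [mu ->] := lebesgue_tupleP n; exact: sigma_finiteT. Qed.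

HB.instance Definition _ n := Measure_isSigmaFinite.Build _ _ _
  (@lebesgue_tuple R n) (@lebesgue_tuple_sigma_finite n).

End lebesgue_tuple_measure.

Local Open Scope ereal_scope.

Definition unit_ball_measure {R : realType} (n : nat) (A : set (n.-tuple R))
    : \bar R :=
  \int[@lebesgue_tuple R n]_(y in A) (\1_(eball evec0 1%R) y)%:E.

Section unit_ball_measure_measure.
Context {R : realType} (n : nat).
Local Notation nu := (@unit_ball_measure R n).

Let unit_ball_measure0 : nu set0 = 0.
Proof. exact: integral_set0. Qed.

Let unit_ball_measure_ge0 A : 0 <= nu A.
Proof. by apply: integral_ge0 => y _; rewrite lee_fin. Qed.

Let unit_ball_measure_sigma_additive : semi_sigma_additive nu.
Proof.
move=> F mF tF mUF.
rewrite [X in _ --> X](_ : _ = \sum_(k <oo) nu (F k)).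
  by apply/cvg_closeP; split; [exact: is_cvg_nneseries|rewrite closeE].
rewrite /unit_ball_measure ge0_integral_bigcup//.
apply/measurable_EFinP; apply: measurable_funTS.
apply: measurable_indic; exact: measurable_eball.
Qed.

HB.instance Definition _ := isMeasure.Build _ _ _ nu
  unit_ball_measure0 unit_ball_measure_ge0 unit_ball_measure_sigma_additive.

End unit_ball_measure_measure.

Section operators.
Context {R : realType} {n : nat}.
Implicit Types (g : n.-tuple R -> \bar R) (x : n.-tuple R).

Definition average (mu : set (n.-tuple R) -> \bar R) (A : set (n.-tuple R)) g :=
  (mu A)^-1 * \int[mu]_(y in A) g y.

Definition maximal_function (mu : {measure set (n.-tuple R) -> \bar R}) g x :=
  ereal_sup [set average mu (eball x r) (fun y => `|g y|)
            | r in [set r : R | (0 < r)%R /\ 0 < mu (eball x r)]].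

(* At the origin the averaging ball is empty; the value there is the limit of
   the averages over shrinking centred balls. *)
Definition hardy g x : \bar R :=
  if enorm x == 0%R
  then lim (average (@lebesgue_tuple R n) (eball evec0 r) g @[r --> 0^'+])
  else average (@lebesgue_tuple R n) (eball evec0 (enorm x)) g.

(* Extended real values allow for unbounded profiles such as |x|^-a, whose
   value at the origin is +oo. *)
Definition radially_decreasing g : Prop :=
  (forall x, 0 <= g x) /\
  exists2 g0 : R -> \bar R,
    (forall r s : R, (0 <= r)%R -> (r <= s)%R -> g0 s <= g0 r) &
    forall x, g x = g0 (enorm x).

End operators.

(* Main.v *)
(** Write [t = |x|] and [A] for the right-hand average, [A^p = (g^p)_{B_t}].
    Monotonicity gives [g <= A (t / |y|)^(n/p)] inside [B_t] and [g <= A]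
    outside, so it suffices to know how much of [B(x, r)] lies in the small
    balls [B_{st}].  The map [y |-> s x + sqrt s (y - x)] sends
    [B(x, r) `&` B_t] onto a superset of [B(x, r) `&` B_{st}], hence
    [|B(x, r) `&` B_{st}| <= s^(n/2) |B(x, r) `&` B_1|].  Summing over the radii
    [s = a^(-kp/n)] yields a geometric series, convergent for [p > 2], which
    tends to the constant [p / (p - 2)] as [a -> 1]; the slack up to
    [(p + 2) / (p - 2)] allows an explicit [a > 1].
    For [x = 0], averages over centred balls grow as the radius shrinks, so each
    of them is at most the limit defining the Hardy operator at the origin. *)

Require Import Defs.
From mathcomp Require Import all_boot all_order all_algebra.
From mathcomp Require Import all_classical all_reals all_analysis.
From mathcomp Require Import measurable_realfun zify ring lra.
Set Implicit Arguments.
Unset Strict Implicit.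
Unset Printing Implicit Defensive.
Import Order.TTheory GRing.Theory Num.Theory.
Import numFieldNormedType.Exports.
Local Open Scope classical_set_scope.
Local Open Scope ring_scope.
Local Open Scope ereal_scope.

(** * Affine changes of variables for Lebesgue measure *)

Definition taffine {R : realType} {n : nat} (v : n.-tuple R) (c : R)
    (y : n.-tuple R) : n.-tuple R :=
  [tuple (tnth v i + c * tnth y i)%R | i < n].

Lemma measurable_taffine (R : realType) (n : nat) (v : n.-tuple R) (c : R) :
  measurable_fun setT (taffine v c).
Proof.
apply/measurable_fun_tnthP => i.
rewrite (_ : _ \o _ = fun y : n.-tuple R => (tnth v i + c * tnth y i)%R).
  apply: measurable_funD => //; apply: measurable_funM => //.
  exact: measurable_tnth.
by apply/funext => y /=; rewrite tnth_mktuple.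
Qed.

(** The scaled pushforward is a measure that agrees with Lebesgue measure on half-open intervals,
    and these determine it. *)
Lemma lebesgue_measure_affine (R : realType) (v c : R)
    (A : set (measurableTypeR R)) : (0 < c)%R -> measurable A ->
  c%:E * lebesgue_measure ((fun x => v + c * x)%R @^-1` A) = lebesgue_measure A.
Proof.
move=> c0 mA; have c0' := ltW c0.
pose f : measurableTypeR R -> measurableTypeR R := fun x => (v + c * x)%R.
have mf : measurable_fun setT f by apply: measurable_funD.
pose mu : {measure set _ -> \bar R} :=
  mscale (NngNum c0') (pushforward lebesgue_measure f).
suff : lebesgue_measure A = mu mf A by [].
apply: lebesgue_measure_unique => // _ [[a b]] _ <-.
change (lebesgue_measure `]a, b]%classic =
  c%:E * lebesgue_measure (f @^-1` `]a, b]%classic)).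
rewrite (_ : f @^-1` _ = `](a - v) / c, (b - v) / c]%classic)%R; last first.
  apply/seteqP; split=> x; rewrite /= !in_itv /= /f ltr_pdivrMr// ler_pdivlMr//.
    by rewrite ltrBlDl lerBrDl mulrC.
  by rewrite ltrBlDl lerBrDl mulrC.
rewrite !lebesgue_measure_itv/= !lte_fin ltr_pM2r ?invr_gt0// ltrD2r.
case: ifPn => _; last by rewrite mule0.
rewrite -!EFinB -EFinM; congr EFin; field; exact: lt0r_neq0.
Qed.

(** Induction on the dimension: through [tcons] the map acts separately on the head and the tail, so
    by uniqueness of the product measure it suffices to check rectangles, where each side
    contributes its own power of [c]. *)
Lemma lebesgue_tuple_affine (R : realType) (n : nat) (v : n.-tuple R) (c : R)
    (A : set (n.-tuple R)) : (0 < c)%R -> measurable A ->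
  (c ^+ n)%:E * lebesgue_tuple (taffine v c @^-1` A) = lebesgue_tuple A.
Proof.
move=> c0; elim: n v A => [|n IHn] v A mA.
  rewrite expr0 mul1e; congr (lebesgue_tuple _).
  by apply/seteqP; split=> y; rewrite /= [y]tuple0 [taffine _ _ _]tuple0.
pose v0 := thead v; pose v1 : n.-tuple R := [tuple of behead v].
pose f1 : measurableTypeR R -> measurableTypeR R := fun x => (v0 + c * x)%R.
have mf1 : measurable_fun setT f1 by apply: measurable_funD.
pose T := (measurableTypeR R * n.-tuple R)%type.
pose f (w : T) : T := (f1 w.1, taffine v1 c w.2).
have mf : measurable_fun setT f.
  apply: measurable_fun_pair; first exact: measurableT_comp.
  by apply: measurableT_comp => //; exact: measurable_taffine.
pose mu : {measure set T -> \bar R} := mscale (NngNum (exprn_ge0 n.+1 (ltW c0)))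
  (pushforward (lebesgue_measure \x @lebesgue_tuple R n) f).
have fE (w : T) : taffine v c (tcons w) = tcons (f w).
  apply: eq_from_tnth => i; rewrite tnth_mktuple.
  have [j ->|->] := unliftP ord0 i.
    rewrite !tnthS tnth_mktuple; congr (_ + _)%R.
    by rewrite [v in LHS]tuple_eta tnthS.
  by rewrite !tnth0.
rewrite /= /pushforward.
rewrite (_ : @tcons R n @^-1` (taffine v c @^-1` A) =
    f @^-1` (@tcons R n @^-1` A)); last first.
  by apply/seteqP; split=> w; rewrite /= fE.
transitivity (mu mf (@tcons R n @^-1` A)) => //.
apply/esym/product_measure_unique; last first.
  by rewrite -[X in measurable X]setTI; apply: measurable_tcons.
move=> X Y mX mY.
change ((c ^+ n.+1)%:E *
    (lebesgue_measure \x @lebesgue_tuple R n) (f @^-1` (X `*` Y)) =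
  lebesgue_measure X * lebesgue_tuple Y).
rewrite (_ : f @^-1` _ = (f1 @^-1` X) `*` (taffine v1 c @^-1` Y))//.
rewrite product_measure1E//; last 2 first.
  - by rewrite -[X in measurable X]setTI; apply: mf1.
  - by rewrite -[X in measurable X]setTI; apply: measurable_taffine.
rewrite exprS EFinM muleACA lebesgue_measure_affine//.
by congr (_ * _); exact: IHn.
Qed.

(** * Euclidean balls: scaling, finiteness, positivity and lenses *)

Section euclidean_balls.
Context {R : realType}.
Implicit Types (n : nat) (r t : R).

Lemma enorm_ge0 n (x : n.-tuple R) : (0 <= enorm x)%R.
Proof. exact: sqrtr_ge0. Qed.

Lemma sqr_enorm n (x : n.-tuple R) :
  (enorm x ^+ 2 = \sum_(i < n) tnth x i ^+ 2)%R.
Proof. by rewrite sqr_sqrtr// sumr_ge0// => i _; exact: sqr_ge0. Qed.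

Lemma le_enorm n (x : n.-tuple R) (i : 'I_n) : (`|tnth x i| <= enorm x)%R.
Proof.
rewrite -sqrtr_sqr ler_wsqrtr// (bigD1 i)//= lerDl sumr_ge0// => j _.
exact: sqr_ge0.
Qed.

Lemma enorm_eq0 n (x : n.-tuple R) : enorm x = 0%R -> x = evec0.
Proof.
move=> x0; apply: eq_from_tnth => i; rewrite tnth_mktuple.
by apply/eqP; rewrite -normr_le0 -x0 le_enorm.
Qed.

Lemma eball0E n r : eball evec0 r = [set y : n.-tuple R | (enorm y < r)%R].
Proof.
apply/seteqP; split=> y; rewrite /eball /=; congr (enorm _ < r)%R => //;
  apply: eq_from_tnth => i; by rewrite !tnth_mktuple subr0.
Qed.

Lemma subset_eball0 n r t : (r <= t)%R ->
  @eball R n evec0 r `<=` eball evec0 t.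
Proof. by move=> rt y; rewrite !eball0E /= => /lt_le_trans; apply. Qed.

Lemma measurable_enorm n : measurable_fun setT (@enorm R n).
Proof.
rewrite /enorm; apply: (@measurableT_comp _ _ _ _ _ _ (@Num.sqrt R)).
  exact: (continuous_measurable_fun (@sqrt_continuous R)).
apply: measurable_sum => i; apply: measurable_funX; exact: measurable_tnth.
Qed.

Lemma enorm_scale n (c : R) (y : n.-tuple R) : (0 <= c)%R ->
  enorm (taffine evec0 c y) = (c * enorm y)%R.
Proof.
move=> c0; apply/eqP; rewrite -(@eqrXn2 _ 2)// ?enorm_ge0 ?mulr_ge0 ?enorm_ge0//.
rewrite exprMn !sqr_enorm mulr_sumr; apply/eqP/eq_bigr => i _.
by rewrite !tnth_mktuple add0r exprMn.
Qed.

Lemma lebesgue_eball_scale n (c r : R) : (0 < c)%R ->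
  lebesgue_tuple (@eball R n evec0 (c * r)) =
  (c ^+ n)%:E * lebesgue_tuple (@eball R n evec0 r).
Proof.
move=> c0; rewrite -(@lebesgue_tuple_affine _ _ evec0 c)//; last first.
  exact: measurable_eball.
congr (_ * lebesgue_tuple _); apply/seteqP; split=> y.
  by rewrite !eball0E /= enorm_scale ?ltW// ltr_pM2l.
by rewrite !eball0E /= enorm_scale ?ltW// ltr_pM2l.
Qed.

(** The sup-norm ball, a product of intervals with explicit volume. Comparison with cubes shows that
    Euclidean balls have finite and positive measure. *)
Definition cube n (r : R) : set (n.-tuple R) :=
  [set y | forall i, (`|tnth y i| < r)%R].

Lemma measurable_cube n r : measurable (@cube n r).
Proof.
rewrite (_ : cube _ = \bigcap_(i in [set: 'I_n])
    (fun y : n.-tuple R => tnth y i) @^-1` [set` `]-r, r[%R]).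
  apply: fin_bigcap_measurable => // i _.
  by rewrite -[X in measurable X]setTI; apply: measurable_tnth.
apply/seteqP; split=> [y yr i _|y yr i].
  by rewrite /= in_itv /= -ltr_norml; exact: yr.
by have := yr i Logic.I; rewrite /= in_itv /= -ltr_norml.
Qed.

Lemma lebesgue_cube n r : (0 < r)%R ->
  lebesgue_tuple (@cube n r) = ((r *+ 2) ^+ n)%:E.
Proof.
move=> r0; elim: n => [|n IHn].
  rewrite expr0 /= (_ : cube r = setT) ?diracT//.
  by apply/seteqP; split=> // y _ [].
rewrite /= /pushforward (_ : _ @^-1` _ = [set` `](- r)%R, r[] `*` @cube n r).
  rewrite product_measure1E//; last exact: measurable_cube.
  rewrite exprS EFinM -IHn; congr (_ * _).
  have -> : ((r *+ 2)%:E = lebesgue_measure [set` `](- r)%R, r[])%R; last by [].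
  rewrite lebesgue_measure_itv/= lte_fin gtrN// -EFinB.
  by rewrite opprK mulr2n.
apply/seteqP; split=> -[a y] /=; rewrite in_itv /= -ltr_norml.
  move=> h; split; first by have := h ord0; rewrite tnth0.
  by move=> i; have := h (lift ord0 i); rewrite tnthS.
move=> [ha hy] i; have [j ->|->] := unliftP ord0 i; last by rewrite tnth0.
by rewrite tnthS; exact: hy.
Qed.

Lemma lebesgue_eball_lty n r : lebesgue_tuple (@eball R n evec0 r) < +oo.
Proof.
have [r0|r0] := ltP 0%R r.
  apply: (@le_lt_trans _ _ (lebesgue_tuple (@cube n r))); last first.
    by rewrite lebesgue_cube ?ltry.
  apply: le_measure; rewrite ?inE; [exact: measurable_eball|exact: measurable_cube|].
  by rewrite eball0E => y /= yr i; exact: le_lt_trans (le_enorm y i) yr.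
rewrite eball0E (_ : [set _ | _] = set0) ?measure0//.
apply/seteqP; split=> // y /=.
by rewrite ltNge (le_trans r0)// enorm_ge0.
Qed.

Lemma lebesgue_eball_gt0 n r : (0 < r)%R ->
  0 < lebesgue_tuple (@eball R n evec0 r).
Proof.
(* With half-side [r / (n + 1)] the squared norm is at most [n r^2 / (n + 1)^2 < r^2]; taking
   [n + 1] rather than [n] also covers dimension 0. *)
move=> r0; have s0 : (0 < r / n.+1%:R)%R by rewrite divr_gt0.
apply: (@lt_le_trans _ _ (lebesgue_tuple (@cube n (r / n.+1%:R)))).
  by rewrite lebesgue_cube// lte_fin exprn_gt0// mulrn_wgt0.
apply: le_measure; rewrite ?inE; [exact: measurable_cube|exact: measurable_eball|].
rewrite eball0E => y yr /=.
rewrite -(@ltr_pXn2r _ 2) ?nnegrE ?enorm_ge0 ?(ltW r0)// sqr_enorm.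
apply: (@le_lt_trans _ _ (\sum_(i < n) (r / n.+1%:R) ^+ 2)%R).
  apply: ler_sum => i _; rewrite -real_normK ?num_real//.
  by rewrite ler_pXn2r ?nnegrE ?(ltW s0)// ltW//; exact: yr.
rewrite sumr_const card_ord -[ltLHS]mulr_natr.
rewrite -[ltRHS](divfK (_ : n.+1%:R ^+ 2 != 0)%R) ?expf_neq0//.
rewrite -expr_div_n ltr_pM2l ?exprn_gt0// -natrX ltr_nat; nia.
Qed.

(* The dilation [w |-> b w], with the point [x] sent to [b^2 x], maps the lens
   [B(x, r) `&` B(0, t)] onto a set containing its smaller analogue: for
   [t = |x|], a point [z = b^2 x + b w] lies in [B(0, b^2 t)] iff
   [2 b <x, w> + |w|^2 < 0]. *)
Lemma lens_subset n (x : n.-tuple R) (b r : R) : (0 < b <= 1)%R ->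
  taffine (taffine evec0 (b ^+ 2 - b) x) b @^-1`
    (eball x r `&` eball evec0 (b ^+ 2 * enorm x)) `<=`
  eball x r `&` eball evec0 (enorm x).
Proof.
move=> /andP[b0 b1] y; rewrite /= !eball0E /eball /=.
set z := taffine _ _ y.
(* Every vector below is a combination of [x] and [w = y - x], so each squared norm is a quadratic
   expression in [X = |x|^2], [W = |w|^2] and [D = <x, w>]. *)
pose w i := (tnth y i - tnth x i)%R.
pose X := (\sum_i tnth x i ^+ 2)%R; pose W := (\sum_i w i ^+ 2)%R.
pose D := (\sum_i tnth x i * w i)%R.
have sumE (p q : R) :
    (\sum_i (p * tnth x i + q * w i) ^+ 2 =
     p ^+ 2 * X + p * q *+ 2 * D + q ^+ 2 * W)%R.
  rewrite !mulr_sumr -!big_split; apply: eq_bigr => i _ /=; ring.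
have zE i : tnth z i = (b ^+ 2 * tnth x i + b * w i)%R.
  by rewrite !tnth_mktuple /w; ring.
have W0 : (0 <= W)%R by apply: sumr_ge0 => i _; exact: sqr_ge0.
have X0 : (0 <= X)%R by apply: sumr_ge0 => i _; exact: sqr_ge0.
move=> [zxr zb].
have r0 : (0 < r)%R by exact: le_lt_trans (enorm_ge0 _) zxr.
have b2 : (0 < b ^+ 2)%R by rewrite exprn_gt0.
have {}zb : (b * D *+ 2 + W < 0)%R.
  move: zb; rewrite -(@ltr_pXn2r _ 2) ?nnegrE ?enorm_ge0//; last first.
    by rewrite mulr_ge0 ?enorm_ge0// ltW.
  rewrite exprMn !sqr_enorm -/X; under eq_bigr do rewrite zE.
  rewrite sumE -subr_lt0 => h; rewrite -(pmulr_rlt0 _ b2).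
  by apply: le_lt_trans h; rewrite le_eqVlt; apply/orP; left; apply/eqP; ring.
have bD : (b * D < 0)%R by lra.
have D0 : (D < 0)%R by rewrite pmulr_rlt0 in bD.
split.
  move: zxr; rewrite -!(@ltr_pXn2r _ 2 _ (enorm _)) ?nnegrE ?enorm_ge0 ?(ltW r0)//.
  rewrite !sqr_enorm.
  under eq_bigr do rewrite tnth_mktuple zE.
  rewrite (_ : (\sum_i _)%R =
    (\sum_i ((b ^+ 2 - 1) * tnth x i + b * w i) ^+ 2)%R); last first.
    by apply: eq_bigr => i _; ring.
  rewrite sumE => h; under eq_bigr do rewrite tnth_mktuple.
  rewrite -/W; apply: le_lt_trans h.
  (* The difference [|z - x|^2 - |y - x|^2] is exactly the sum of this term and the next one. *)
  have : (0 <= (b ^+ 2 - 1) ^+ 2 * X)%R by rewrite mulr_ge0// sqr_ge0.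
  have : (0 <= (1 - b ^+ 2) * (- (b * D *+ 2 + W)))%R.
    by rewrite mulr_ge0 ?oppr_ge0 ?(ltW zb)// subr_ge0 expr_le1// ltW.
  lra.
rewrite -(@ltr_pXn2r _ 2) ?nnegrE ?enorm_ge0// !sqr_enorm.
rewrite (_ : (\sum_i _)%R = (\sum_i (1 * tnth x i + 1 * w i) ^+ 2)%R); last first.
  by apply: eq_bigr => i _; rewrite /w; ring.
rewrite sumE -/X.
(* Here [|y|^2 - |x|^2 = 2 D + W = (2 b D + W) + 2 (1 - b) D], a negative term plus a nonpositive
   one. *)
have : (0 <= (1 - b) * (- D))%R by rewrite mulr_ge0 ?oppr_ge0 ?subr_ge0 ?(ltW D0).
lra.
Qed.

(** The map [y |-> (b^2 - b) x + b y] multiplies volumes by [b^n], and the preimage of the small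
    lens lies in the large one. *)
Lemma lebesgue_lens n (x : n.-tuple R) (b r : R) : (0 < b <= 1)%R ->
  lebesgue_tuple (eball x r `&` eball evec0 (b ^+ 2 * enorm x)) <=
  (b ^+ n)%:E * lebesgue_tuple (eball x r `&` eball evec0 (enorm x)).
Proof.
move=> b01; have /andP[b0 _] := b01.
have mL s : measurable (eball x r `&` eball evec0 s).
  by apply: measurableI; exact: measurable_eball.
rewrite -(@lebesgue_tuple_affine _ _ (taffine evec0 (b ^+ 2 - b)%R x) b)//.
rewrite lee_pmul2l ?lte_fin ?exprn_gt0//; apply: le_measure; rewrite ?inE//.
  by rewrite -[X in measurable X]setTI; apply: measurable_taffine.
exact: lens_subset.
Qed.

End euclidean_balls.

(** * Integrals estimated by a geometric series of layers *)

Lemma nneseries_le_ub (R : realType) (u : (\bar R)^nat) (M : \bar R) :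
  (forall k, 0 <= u k) -> (forall N, \sum_(0 <= k < N) u k <= M) ->
  \sum_(k <oo) u k <= M.
Proof.
move=> u0 uM; apply: lime_le; first exact: is_cvg_nneseries.
by apply: nearW => N; exact: uM.
Qed.

Section geometric_layers.
Context d (T : measurableType d) (R : realType).
Variables (mu : {measure set T -> \bar R}) (E : set T) (rad : T -> R).
Hypotheses (mE : measurable E) (mrad : measurable_fun setT rad).
Variables (g : T -> \bar R) (s : R^nat) (a q c : R).
Hypotheses (mg : measurable_fun setT g) (g0 : forall y, 0 <= g y).
Hypotheses (a1 : (1 < a)%R) (q0 : (0 <= q)%R) (aq1 : (a * q < 1)%R).
Hypothesis c0 : (0 < c)%R.
Hypothesis g_le : forall k y, (s k <= rad y)%R -> g y <= (c * a ^+ k)%:E.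
Hypothesis mu_le : forall k,
  mu (E `&` [set y | (rad y < s k)%R]) <= (q ^+ k)%:E * mu E.

Let B k := [set y | (rad y < s k)%R].

Let mB k : measurable (B k).
Proof.
rewrite (_ : B k = setT `&` rad @^-1` [set` `]-oo, s k[%R]); first exact: mrad.
by rewrite setTI; apply/seteqP; split => y /=; rewrite in_itv.
Qed.

(** The weight is the increment [a^(k+1) - a^k], so [1] plus the first [k] weights telescopes to
    [a^k]. *)
Let h k y : \bar R := ((a - 1) * a ^+ k)%:E * (\1_(B k) y)%:E.

Let h_ge0 k y : 0 <= h k y.
Proof.
by rewrite mule_ge0 ?lee_fin// mulr_ge0 ?exprn_ge0//; move: a1; lra.
Qed.

Let sum_h k y : (forall j, (j < k)%N -> (rad y < s j)%R) ->
  (a ^+ k)%:E <= 1 + \sum_(j <oo) h j y.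
Proof.
move=> yk; have -> : (a ^+ k)%:E = 1 + \sum_(0 <= j < k) h j y.
  rewrite (eq_big_nat _ _ (F2 := fun j => ((a - 1) * a ^+ j)%:E)); last first.
    move=> j /andP[_ jk]; rewrite /h indicE mem_set ?mule1//; exact: yk.
  rewrite sumEFin -mulr_sumr big_mkord -subrX1 -EFinD; congr EFin; ring.
by rewrite leeD2l// nneseries_lim_ge.
Qed.

(** If [m] is the least index with [s m <= rad y], then [g y <= c a^m], while [y] lies in all
    earlier layers and these already sum to [a^m]. *)
Let g_le_sum y : g y <= c%:E * (1 + \sum_(k <oo) h k y).
Proof.
have [[k sk]|noN] := pselect (exists k, (s k <= rad y)%R).
  have [m sm mmin] := ex_minnP (ex_intro (fun k => s k <= rad y)%R k sk).
  rewrite (le_trans (g_le sm))// EFinM lee_pmul2l// sum_h// => j jm.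
  by rewrite ltNge; apply/negP => /mmin; rewrite leqNgt jm.
(* A point in every layer, such as the origin, where [g] may be [+oo]: the series diverges there,
   since [a^k >= k (a - 1)] is unbounded. *)
rewrite (_ : 1 + _ = +oo) ?gt0_muley ?leey ?lte_fin//.
apply: eq_infty => r.
have [k rk] : exists k, (r <= a ^+ k)%R.
  exists (Num.bound `|(r / (a - 1))%R|%R); rewrite ltW//.
  have /(le_lt_trans (ler_norm _)) := archi_boundP (normr_ge0 (r / (a - 1))%R).
  rewrite ltr_pdivrMr ?subr_gt0// => /lt_le_trans; apply.
  move: (Num.bound _) => k; elim: k => [|k IHk].
    by rewrite mul0r expr0 ler01.
  rewrite exprS -natr1; have : (1 <= a ^+ k)%R by rewrite exprn_ege1 ?ltW.
  by move: a1 IHk; nra.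
apply: (@le_trans _ _ (a ^+ k)%:E); first by rewrite lee_fin.
apply: sum_h => j _; rewrite ltNge; apply/negP => sj; apply: noN; by exists j.
Qed.

(** Integrating the pointwise bound term by term, layer [k] costs at most [(a - 1) (a q)^k mu(E)],
    and these costs sum to [(a - 1) / (1 - a q)] times [mu(E)]. *)
Lemma le_integral_geometric_layers :
  \int[mu]_(y in E) g y <= (c * (1 + (a - 1) / (1 - a * q)))%:E * mu E.
Proof.
have a0 : (0 < a)%R by rewrite (lt_trans _ a1).
have a10 : (0 < a - 1)%R by rewrite subr_gt0.
have mind k : measurable_fun E (fun y => (\1_(B k) y : R)%:E).
  apply/measurable_EFinP; exact/measurable_funTS/measurable_indic.
have mh k : measurable_fun E (h k) by exact: measurable_funeM.
have msum : measurable_fun E (fun y => \sum_(k <oo) h k y).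
  by apply: ge0_emeasurable_sum => //.
apply: (@le_trans _ _ (\int[mu]_(y in E) (c%:E * (1 + \sum_(k <oo) h k y)))).
  apply: ge0_le_integral => //.
  - exact: measurable_funTS.
  - by apply: measurable_funeM; apply: emeasurable_funD.
rewrite ge0_integralZl_EFin ?(ltW c0)//; last 2 first.
- by move=> y _; rewrite adde_ge0// nneseries_ge0.
- exact: emeasurable_funD.
rewrite EFinM -muleA lee_pmul2l//.
rewrite ge0_integralD//; last by move=> y _; rewrite nneseries_ge0.
rewrite integral_cst// mul1e integral_nneseries//.
rewrite EFinD ge0_muleDl//; last first.
  by rewrite lee_fin divr_ge0 ?subr_ge0 ?(ltW a1) ?(ltW aq1).
rewrite mul1e leeD2l//.
apply: nneseries_le_ub => [k|M]; first exact: integral_ge0.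
apply: (@le_trans _ _ (\sum_(0 <= k < M) ((a - 1) * (a * q) ^+ k)%:E * mu E)).
  apply: lee_sum => k _; rewrite ge0_integralZl_EFin//; last first.
    by rewrite mulr_ge0 ?exprn_ge0// ltW.
  rewrite integral_indic//.
  have -> : ((a - 1) * (a * q) ^+ k)%:E = ((a - 1) * a ^+ k)%:E * (q ^+ k)%:E.
    by rewrite -EFinM exprMn mulrA.
  rewrite -muleA lee_pmul2l ?lte_fin//.
    by rewrite setIC mu_le.
  by rewrite mulr_gt0 ?exprn_gt0.
rewrite -ge0_sume_distrl; last first.
  by move=> k _; rewrite lee_fin mulr_ge0 ?exprn_ge0 ?mulr_ge0// ltW.
rewrite lee_wpmul2r// sumEFin lee_fin.
have /(congr1 (@^~ M)) := geometric_seriesE (a - 1)%R (negbT (lt_eqF aq1)).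
rewrite /= -[leLHS]/(series (geometric (a - 1) (a * q)) M)%R => ->.
rewrite ler_pM2r ?invr_gt0 ?subr_gt0//.
by rewrite ger_pMr// gerBl exprn_ge0// mulr_ge0// ltW.
Qed.

End geometric_layers.

(** * Radially decreasing functions and their averages over centred balls *)

Section radially_decreasing_functions.
Context {R : realType} {n : nat}.
Implicit Types (f g : n.-tuple R -> \bar R) (r t : R).
Local Notation leb := (@lebesgue_tuple R n).
Local Notation B r := (@eball R n evec0 r).

Lemma radially_decreasing_le f (y z : n.-tuple R) : radially_decreasing f ->
  (enorm y <= enorm z)%R -> f z <= f y.
Proof.
by move=> [_ [f0 f0_ni fE]] yz; rewrite !fE; apply: f0_ni => //; exact: enorm_ge0.
Qed.

Lemma radially_decreasing_poweR g (p : R) : (0 <= p)%R ->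
  radially_decreasing g -> radially_decreasing (fun y => g y `^ p).
Proof.
move=> p0 [g0 [h h_ni gE]]; split=> [y|]; first exact: poweR_ge0.
(* The profile is known to be nonnegative only at radii of the form [enorm y]; truncation at 0 makes
   the power monotone at every radius. *)
exists (fun r => maxe 0 (h r) `^ p) => [r s r0 rs|y].
  have max_itv u : maxe 0 (h u) \in `[0, +oo].
    by rewrite in_itv/= leey andbT le_max lexx.
  apply: gt0_ler_poweR => //.
  by rewrite ge_max !le_max lexx/= h_ni ?orbT.
by rewrite -gE; congr (_ `^ _); rewrite max_r.
Qed.

(** Each superlevel set is the preimage under the norm of an interval of radii. *)
Lemma measurable_radially_decreasing f : radially_decreasing f ->
  measurable_fun setT f.
Proof.
move=> [_ [h h_ni fE]].
apply: (measurability _ (ErealGenOInfty.measurableE R)) => // _ [_ [a ->] <-].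
rewrite setTI (_ : f @^-1` _ =
    setT `&` @enorm R n @^-1` [set r | (0 <= r)%R /\ a%:E < h r]).
  apply: measurable_enorm => //; apply: is_interval_measurable.
  move=> r s [r0 _] [_ sa] u /andP[ru us]; split; first exact: le_trans ru.
  by apply: (lt_le_trans sa); apply: h_ni => //; exact: le_trans ru.
rewrite setTI; apply/seteqP; split=> y /=; rewrite in_itv/= andbT fE.
  by move=> ay; split=> //; exact: enorm_ge0.
by case.
Qed.

Lemma lebesgue_eballE :
  exists2 V : R, (0 < V)%R &
    forall r, (0 < r)%R -> leb (B r) = (r ^+ n * V)%:E.
Proof.
have V0 := lebesgue_eball_gt0 n (@ltr01 R).
have Vfin : leb (B 1%R) \is a fin_num.
  by rewrite ge0_fin_numE ?ltW// lebesgue_eball_lty.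
exists (fine (leb (B 1%R))); first by rewrite -lte_fin fineK.
move=> r r0; rewrite EFinM fineK// -[in LHS](mulr1 r).
exact: lebesgue_eball_scale.
Qed.

Lemma average_eball_ge0 f r : (forall y, 0 <= f y) ->
  0 <= average leb (B r) f.
Proof. by move=> f0; rewrite mule_ge0 ?inve_ge0 ?integral_ge0. Qed.

Lemma average_eball_le f t (M : R) : (0 < t)%R ->
  (average leb (B t) f <= M%:E) = (\int[leb]_(y in B t) f y <= M%:E * leb (B t)).
Proof.
move=> t0; have [V V0 VE] := lebesgue_eballE.
have tV : (0 < t ^+ n * V)%R by rewrite mulr_gt0 ?exprn_gt0.
by rewrite /average VE// inver gt_eqF// lee_pdivrMl// muleC.
Qed.

(** Chebyshev's argument: [f >= f y] on [B rho], hence [f y |B rho| <= M |B t|], and the ratio of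
    volumes is [(t / rho)^n]. *)
Lemma radially_decreasing_weak_type f t (rho M : R) (y : n.-tuple R) :
  radially_decreasing f -> (0 < rho <= t)%R -> (rho <= enorm y)%R ->
  average leb (B t) f <= M%:E -> f y <= (M * (t / rho) ^+ n)%:E.
Proof.
move=> frd /andP[rho0 rhot] rhoy; have t0 := lt_le_trans rho0 rhot.
have [V V0 VE] := lebesgue_eballE.
have mf := measurable_radially_decreasing frd; have [f0 _] := frd.
have mB s : measurable (B s) by exact: measurable_eball.
rewrite average_eball_le// => Mt.
have W0 : (0 < rho ^+ n * V)%R by rewrite mulr_gt0 ?exprn_gt0.
rewrite -(@lee_pmul2r _ (rho ^+ n * V)%:E) ?lte_fin//.
apply: (@le_trans _ _ (\int[leb]_(z in B rho) f z)).
  rewrite -VE// -integral_cst//; apply: ge0_le_integral => //.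
  - by move=> z _; exact: f0.
  - exact: measurable_funTS.
  - move=> z; rewrite eball0E /= => zrho.
    by apply: (radially_decreasing_le frd); rewrite ltW// (lt_le_trans zrho).
apply: (@le_trans _ _ (\int[leb]_(z in B t) f z)).
  apply: ge0_subset_integral => //; first exact: measurable_funTS.
  exact: subset_eball0.
apply: (le_trans Mt); rewrite VE// -!EFinM lee_fin le_eqVlt; apply/orP; left.
by apply/eqP; rewrite expr_div_n; field; rewrite expf_neq0// gt_eqF.
Qed.

(** On [B t] minus [B r] the function is at most its average over [B r], by the weak-type bound with
    both radii equal to [r]; adding this shell cannot raise the average. *)
Lemma average_eball_nonincreasing f r t : radially_decreasing f ->
  (0 < r <= t)%R -> average leb (B t) f <= average leb (B r) f.
Proof.
move=> frd /andP[r0 rt]; have t0 := lt_le_trans r0 rt.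
have mf := measurable_radially_decreasing frd; have [f0 _] := frd.
have mB s : measurable (B s) by exact: measurable_eball.
have : 0 <= average leb (B r) f by exact: average_eball_ge0.
case E : (average leb (B r) f) => [M| |] // M0; last by rewrite leey.
have Mr : average leb (B r) f <= M%:E by rewrite E.
have BE : B t = B r `|` (B t `\` B r).
  by rewrite setDE setUIr setUCr setIT setUidr//; exact: subset_eball0.
have dB : [disjoint B r & B t `\` B r]%classic.
  by apply/disj_setPS => y [? []].
have mD : measurable (B t `\` B r) by exact: measurableD.
rewrite average_eball_le// BE ge0_integral_setU//; last first.
  exact: measurable_funTS.
rewrite measureU//; last by apply/eqP; rewrite -[_ == _]/(disj_set _ _).
rewrite ge0_muleDr ?measure_ge0//; apply: leeD; first by rewrite -average_eball_le.
rewrite -integral_cst//; apply: ge0_le_integral => //.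
  exact: measurable_funTS.
move=> y [_]; rewrite eball0E /= => /negP; rewrite -leNgt => ry.
have := radially_decreasing_weak_type frd _ ry Mr.
by rewrite divff ?gt_eqF// expr1n mulr1; apply; rewrite r0 lexx.
Qed.

Lemma average_eball_le_hardy f t (x : n.-tuple R) : radially_decreasing f ->
  (0 < t)%R -> enorm x = 0%R \/ enorm x = t ->
  average leb (B t) f <= hardy f x.
Proof.
move=> frd t0 xt; rewrite /hardy; case: eqP => [_|x0]; last first.
  by case: xt => // ->.
(* At the origin, monotonicity in the radius turns the limit into a supremum over all positive
   radii. *)
rewrite (cvg_lim _ (@nonincreasing_at_right_cvge _ _ _ (BInfty _ false) _ _))//.
  by apply: ereal_sup_ubound; exists t => //=; rewrite in_itv/= t0.
move=> r s; rewrite !in_itv/= !andbT => r0 s0 rs.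
by apply: average_eball_nonincreasing; rewrite ?r0.
Qed.

End radially_decreasing_functions.

(** * Choice of the ratio of the geometric layers *)

Lemma layer_ratio_exists (R : realType) (p : R) : (2 < p)%R ->
  exists2 v : R, (0 < v)%R &
    (1 + (expR v - 1) / (1 - expR (- (v * (p / 2 - 1)))) <= (p + 2) / (p - 2))%R.
Proof.
move=> p2; pose be := (p / 2 - 1)%R; rewrite -/be.
have be0 : (0 < be)%R by rewrite /be; lra.
have D0 : (0 < 3 * (1 + be))%R by lra.
(* This makes both [v] and [v be] at most 1/3. Then [exp v - 1 <= 3/2 v] and
   [1 - exp(- v be) >= 3/4 v be], so the quotient is at most [2 / be], which is the target minus
   1. *)
exists (3 * (1 + be))^-1%R; first by rewrite invr_gt0.
set v := (_^-1)%R; have v0 : (0 < v)%R by rewrite invr_gt0.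
have vE : (v * (3 * (1 + be)) = 1)%R by rewrite mulVf ?gt_eqF.
have w0 : (0 < v * be)%R by rewrite mulr_gt0.
have ev : (expR v <= 1 + 3 / 2 * v)%R.
  have v1 : (1 - v <= expR (- v))%R by exact: expR_ge1Dx.
  have e0 : (0 < expR v)%R by exact: expR_gt0.
  have e1 : (expR v * expR (- v) = 1)%R by rewrite -expRD subrr expR0.
  have e2 : (expR v * (1 - v) <= 1)%R by rewrite -[leRHS]e1 ler_pM2l.
  have v3 : (v <= 1 / 3)%R by lra.
  have : (1 <= (1 + 3 / 2 * v) * (1 - v))%R by nra.
  by move=> /(le_trans e2); rewrite ler_pM2r//; lra.
have ew : (3 / 4 * (v * be) <= 1 - expR (- (v * be)))%R.
  set w := (v * be)%R in w0 *.
  have w1 : (1 + w <= expR w)%R by exact: expR_ge1Dx.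
  have e0 : (0 < expR (- w))%R by exact: expR_gt0.
  have e1 : (expR (- w) * expR w = 1)%R by rewrite -expRD addNr expR0.
  have e2 : (expR (- w) * (1 + w) <= 1)%R by rewrite -[leRHS]e1 ler_pM2l.
  have w3 : (w <= 1 / 3)%R by rewrite /w; lra.
  have : (1 <= (1 - 3 / 4 * w) * (1 + w))%R by nra.
  have w10 : (0 < 1 + w)%R by lra.
  by move=> /(le_trans e2); rewrite ler_pM2r// => ?; lra.
have -> : ((p + 2) / (p - 2) = 1 + 2 / be)%R.
  by rewrite /be; field; rewrite subr_eq0 gt_eqF.
rewrite lerD2l ler_pdivrMr; last by lra.
apply: (@le_trans _ _ (3 / 2 * v)%R); first by lra.
have -> : (3 / 2 * v = 2 / be * (3 / 4 * (v * be)))%R.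
  by field; rewrite gt_eqF.
by rewrite ler_pM2l// divr_gt0.
Qed.

(** * A single average with respect to the unit ball measure *)

Section unit_ball_measure_average.
Context {R : realType} {n : nat}.
Local Notation nu := (@unit_ball_measure R n).
Local Notation leb := (@lebesgue_tuple R n).
Local Notation B r := (@eball R n evec0 r).

Lemma unit_ball_measureE (A : set (n.-tuple R)) : measurable A ->
  nu A = leb (A `&` B 1%R).
Proof.
move=> mA; rewrite /unit_ball_measure integral_indic//; last exact: measurable_eball.
by rewrite setIC.
Qed.

(* [t] is the radius of the Hardy average: [|x|] for [x != 0], and any radius
   at most [min(r, 1)] for [x = 0]. *)
Lemma unit_ball_measure_layer (x : n.-tuple R) (r t b : R) :
  (0 < b <= 1)%R -> (0 < t <= 1)%R ->
  enorm x = t \/ (enorm x = 0%R /\ (t <= r)%R) ->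
  nu (eball x r `&` B (b ^+ 2 * t)%R) <= (b ^+ n)%:E * nu (eball x r).
Proof.
move=> /andP[b0 b1] /andP[t0 t1] xt.
have mB y s : measurable (@eball R n y s) by exact: measurable_eball.
rewrite !unit_ball_measureE//; last exact: measurableI.
case: xt => [xt|[/enorm_eq0 -> tr]].
  apply: (@le_trans _ _ (leb (eball x r `&` B (b ^+ 2 * enorm x)%R))).
    rewrite xt; apply: le_measure; rewrite ?inE; [|exact: measurableI|].
      by apply: measurableI => //; exact: measurableI.
    exact: subIsetl.
  apply: (le_trans (lebesgue_lens _ _ _)); first by rewrite b0.
  rewrite lee_pmul2l ?lte_fin ?exprn_gt0//; apply: le_measure; rewrite ?inE.
  - exact: measurableI.
  - exact: measurableI.
  - by apply: setIS; apply: subset_eball0; rewrite xt.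
apply: (@le_trans _ _ (leb (B (b ^+ 2 * t)%R))).
  apply: le_measure; rewrite ?inE//.
    by apply: measurableI => //; exact: measurableI.
  by move=> y [[]].
rewrite lebesgue_eball_scale ?exprn_gt0//.
apply: (@le_trans _ _ ((b ^+ n)%:E * leb (B t))).
  rewrite lee_wpmul2r// lee_fin lerXn2r ?nnegrE ?sqr_ge0 ?(ltW b0)//.
  by rewrite expr2 ler_piMl// ltW.
rewrite lee_pmul2l ?lte_fin ?exprn_gt0//; apply: le_measure; rewrite ?inE//.
  exact: measurableI.
by move=> y yt; split; move: y yt; apply: subset_eball0.
Qed.

(** The layer estimate is applied on [B(x, r)] with radii [s k = b^(2k) t]: the weak-type bound for
    [g^p] controls the growth of [g], and the lens estimate controls the measure of the layers. *)
Lemma average_unit_ball_le (g : n.-tuple R -> \bar R) (p : R) (x : n.-tuple R)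
    (r t c v : R) : (0 < n)%N -> radially_decreasing g -> (2 < p)%R ->
  (0 < t <= 1)%R -> enorm x = t \/ (enorm x = 0%R /\ (t <= r)%R) ->
  0 < nu (eball x r) -> (0 < c)%R -> (0 < v)%R ->
  average leb (B t) (fun y => g y `^ p) <= (c `^ p)%:E ->
  average nu (eball x r) (fun y => `|g y|) <=
    (c * (1 + (expR v - 1) / (1 - expR (- (v * (p / 2 - 1))))))%:E.
Proof.
move=> n_gt0 grd p2 t01 xt nu0 c0 v0 avg_le; have /andP[t0 t1] := t01.
have p0 : (0 < p)%R by lra.
have n0 : (n%:R != 0 :> R)%R by rewrite pnatr_eq0 -lt0n.
have gprd := radially_decreasing_poweR (ltW p0) grd; have [g0 _] := grd.
have mE : measurable (eball x r) by exact: measurable_eball.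
(* With [a = exp v], this gives [b^(-2n) = a^p], so the bound on [g] grows by exactly [a] per layer.
   The measure decays by [q = b^n = a^(-p/2)], whence [a q = a^(1 - p/2) < 1]. *)
pose b := expR (- (v * p / 2 / n%:R)).
pose q := expR (- (v * p / 2)).
have b0 : (0 < b)%R by exact: expR_gt0.
have bn : (b ^+ n = q)%R.
  by rewrite /b -expRM_natl /q; congr expR; field.
have b1 : (b <= 1)%R.
  by rewrite -[leRHS]expR0 ler_expR oppr_le0 !mulr_ge0 ?invr_ge0 ?ler0n ?ltW.
have bk k : (0 < b ^+ k <= 1)%R by rewrite exprn_gt0// exprn_ile1// ltW.
have aq : (expR v * q = expR (- (v * (p / 2 - 1))))%R.
  by rewrite -expRD; congr expR; field.
have g_le k y : ((b ^+ k) ^+ 2 * t <= enorm y)%R -> g y <= (c * expR v ^+ k)%:E.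
  move=> ky; have /andP[bk0 bk1] := bk k.
  have s01 : (0 < (b ^+ k) ^+ 2 * t <= t)%R.
    by rewrite mulr_gt0 ?exprn_gt0//= ger_pMl// exprn_ile1// ltW.
  have := radially_decreasing_weak_type gprd s01 ky avg_le.
  have -> : (c `^ p * (t / ((b ^+ k) ^+ 2 * t)) ^+ n = (c * expR v ^+ k) `^ p)%R.
    rewrite powRM ?exprn_ge0 ?expR_ge0 ?(ltW c0)//; congr (_ * _)%R.
    rewrite invfM mulrCA divff ?gt_eqF// mulr1.
    rewrite /b -!expRM_natl -expRN -expRM_natl -expRM; congr expR.
    by field.
  (* Extract [p]-th roots from [g^p <= (c a^k)^p]. *)
  move=> gk.
  have := @gt0_ler_poweR _ p^-1 _ (g y `^ p) ((c * expR v ^+ k) `^ p)%:E.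
  rewrite -poweR_EFin -!poweRrM mulfV ?gt_eqF// !poweRe1//; last first.
    by rewrite lee_fin mulr_ge0 ?exprn_ge0 ?expR_ge0// ltW.
  have itv z : z `^ p \in `[0, +oo] by rewrite in_itv/= poweR_ge0 leey.
  by apply; rewrite ?itv// invr_ge0 ltW.
have nu_le k : nu (eball x r `&` [set y | (enorm y < (b ^+ k) ^+ 2 * t)%R]) <=
    (q ^+ k)%:E * nu (eball x r).
  by rewrite -eball0E -bn (exprAC b n k) unit_ball_measure_layer.
have nu_fin : nu (eball x r) \is a fin_num.
  rewrite ge0_fin_numE ?ltW// unit_ball_measureE//.
  apply: le_lt_trans (lebesgue_eball_lty n 1%R).
  apply: le_measure; rewrite ?inE; [|exact: measurable_eball|exact: subIsetr].
  by apply: measurableI => //; exact: measurable_eball.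
have a1 : (1 < expR v)%R by rewrite expR_gt1.
have aq1 : (expR v * q < 1)%R.
  by rewrite aq -[ltRHS]expR0 ltr_expR oppr_lt0 mulr_gt0//; lra.
have := le_integral_geometric_layers mE (@measurable_enorm R n)
  (measurable_radially_decreasing grd) g0 a1 (expR_ge0 _) aq1 c0 g_le nu_le.
rewrite aq => le_int.
have W0 : (0 < fine (nu (eball x r)))%R by rewrite -lte_fin fineK.
rewrite /average -[nu (eball x r)]fineK// inver gt_eqF// lee_pdivrMl//.
rewrite muleC fineK//; under eq_integral do rewrite gee0_abs//.
exact: le_int.
Qed.

End unit_ball_measure_average.

(** * Supremum over radii and reduction to finite positive bounds *)

Theorem proposition2p5 (R : realType) (n : nat) (n_gt0 : (0 < n)%N)
    (g : n.-tuple R -> \bar R) (g_rd : radially_decreasing g)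
    (p : R) (p_gt2 : (2 < p)%R)
    (x : n.-tuple R) (x_le1 : (enorm x <= 1)%R) :
  maximal_function (@unit_ball_measure R n) g x <=
    ((p + 2) / (p - 2))%R%:E * (hardy (fun y => g y `^ p) x) `^ p^-1.
Proof.
have p0 : (0 < p)%R by lra.
have gprd := radially_decreasing_poweR (ltW p0) g_rd.
apply: ge_ereal_sup => _ [r [r0 nu0] <-].
set H := hardy _ x; set C := ((p + 2) / (p - 2))%R.
have C0 : (0 < C)%R by rewrite divr_gt0//; lra.
(* At the origin the minimum places the centred ball of radius [t] inside both [B(0, r)] and the
   unit ball. *)
pose t := if enorm x == 0%R then Num.min r 1%R else enorm x.
have t01 : (0 < t <= 1)%R.
  rewrite /t; case: eqP => [_|/eqP x0].
    by rewrite lt_min r0 ltr01 ge_min lexx orbT.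
  by rewrite lt_neqAle eq_sym x0 enorm_ge0.
have xt : enorm x = t \/ (enorm x = 0%R /\ (t <= r)%R).
  by rewrite /t; case: eqP => [x0|_]; [right; rewrite ge_min lexx|left].
have HB :
    average (@lebesgue_tuple R n) (eball evec0 t) (fun y => g y `^ p) <= H.
  have /andP[t0 _] := t01; apply: average_eball_le_hardy => //.
  by case: xt => [|[]]; [right|left].
have H0 : 0 <= H.
  by apply: le_trans HB; apply: average_eball_ge0 => y; exact: poweR_ge0.
have [v v0 vC] := layer_ratio_exists p_gt2.
have bound (c : R) : (0 < c)%R -> H `^ p^-1 <= c%:E ->
    average (@unit_ball_measure R n) (eball x r) (fun y => `|g y|) <=
    (C * c)%:E.
  move=> c0 Hc.
  have avg_le :
      average (@lebesgue_tuple R n) (eball evec0 t) (fun y => g y `^ p) <=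
      (c `^ p)%:E.
    apply: (le_trans HB).
    have := @gt0_ler_poweR _ p _ (H `^ p^-1) c%:E.
    rewrite -poweRrM mulVf ?gt_eqF// poweRe1// poweR_EFin.
    by apply; rewrite ?in_itv/= ?poweR_ge0 ?leey ?lee_fin ?(ltW p0) ?(ltW c0).
  have := average_unit_ball_le n_gt0 g_rd p_gt2 t01 xt nu0 c0 v0 avg_le.
  by move=> /le_trans; apply; rewrite lee_fin mulrC ler_pM2r.
have : 0 <= H `^ p^-1 by exact: poweR_ge0.
case E : (H `^ p^-1) => [A| |] // A0; last by rewrite gt0_muley ?leey ?lte_fin.
(* The bound needs [c > 0], while [A] may vanish; [c = A + e / C] is positive and gives
   [C c = C A + e]. *)
apply/lee_addgt0Pr => e e0; rewrite lee_fin in A0.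
have := bound (A + e / C)%R.
rewrite E lee_fin lerDl mulrDr mulrCA divff ?gt_eqF// mulr1 EFinD EFinM; apply.
  by rewrite ltr_wpDl// divr_gt0.
by rewrite divr_ge0 ?ltW.
Qed.
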